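(* Let $X$ be an $n$-element set with $n\ge1$, let $0\le k\le n$, and let $\pi_0\in\Pi_l(X)$ be the labelled set partition of $X$ into singletons of which exactly $k$ are labelled. Let $P(n,k)$ be the number of $\pi\in\Pi_l(X)$ with $\pi\ge\pi_0$ having at least one labelled block. Then \[ P(n,0)=\sum_{j=1}^{n}\binom{n}{j}B(j)B(n-j),\qquad P(n,k)=\sum_{j=0}^{n-k}\binom{n-k}{j}B(k+j)B(n-k-j)\ \text{ for }k\ge1, \] where $B(m)$ is the $m$-th Bell number (number of set partitions of an $m$-element set, $B(0)=1$).
   Context: For a finite set $X$ and a symbol $l\notin X$, a labelled set partition of $X$ is a collection $\pi=\{B_1\cup L_1,\dots,B_k\cup L_k\}$ where $\{B_1,\dots,B_k\}$ is a set partition of $X$ and each $L_i\in\{\emptyset,\{l\}\}$ (labelled block if $L_i=\{l\}$, unlabelled otherwise). $\Pi_l(X)$ is the set of all such, partially ordered by $\sigma\le\pi$ iff every block of $\sigma$ (as a set, including $l$ if present) is contained in some block of $\pi$. *)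

(* Defs.v *)
From mathcomp Require Import all_boot.

Set Implicit Arguments.
Unset Strict Implicit.
Unset Printing Implicit Defensive.

(* The ground set X and the symbol l live in a common finite type T, with the
   hypothesis l \notin X carried by the statement. *)

(* S is the set of those blocks B_i of the underlying partition P for which
   L_i = {l}.  Requiring only that erasing l from pi yield a partition would be
   too weak: it would accept {{x}, {x, l}}. *)
Definition is_labelled_partition (T : finType) (l : T) (X : {set T})
    (pi : {set {set T}}) : bool :=
  [exists P : {set {set T}}, partition P X &&
    [exists S : {set {set T}},
      pi == [set B :|: (if B \in S then [set l] else set0) | B in P]]].

Definition labelled_partitions (T : finType) (l : T) (X : {set T}) :
    {set {set {set T}}} :=
  [set pi | is_labelled_partition l X pi].

Definition refines (T : finType) (sigma pi : {set {set T}}) : bool :=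
  [forall A in sigma, [exists B in pi, A \subset B]].

Definition labelled_blocks (T : finType) (l : T) (pi : {set {set T}}) :
    {set {set T}} :=
  [set C in pi | l \in C].

Definition is_singleton_lp (T : finType) (l : T) (X : {set T}) (k : nat)
    (pi0 : {set {set T}}) : bool :=
  [&& pi0 \in labelled_partitions l X,
      [forall C in pi0, #|C :\ l| == 1]
    & #|labelled_blocks l pi0| == k].

Definition num_labelled_above (T : finType) (l : T) (X : {set T})
    (pi0 : {set {set T}}) : nat :=
  #|[set pi in labelled_partitions l X |
      refines pi0 pi & labelled_blocks l pi != set0]|.

Definition bell (m : nat) : nat :=
  #|[set P : {set {set 'I_m}} | partition P [set: 'I_m]]|.

(* Main.v *)
(** A labelled partition of [X] amounts to a subset [U] of [X], the labelled
    points, with a partition of [U] (the labelled blocks, [l] erased) and a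
    partition of [X :\: U] (the unlabelled blocks).  It lies above [pi0] exactly
    when [U] contains the [k] labelled points of [pi0], and has a labelled block
    exactly when [U] is nonempty.  Hence the number sought is the sum of
    [bell #|U| * bell (n - #|U|)] over these [U], which is then grouped by
    cardinality. *)
Require Import Defs.
From mathcomp Require Import all_boot.

Set Implicit Arguments.
Unset Strict Implicit.
Unset Printing Implicit Defensive.

(** * Set partitions, and sums over the subsets between two given sets *)

Section Partitions.
Variable T : finType.
Implicit Types (U X K : {set T}) (P Q : {set {set T}}).

(** Since [bell] counts partitions of ordinals, partitions are transported along the enumeration of
    [U]: direct images under an injection preserve partitions and act injectively on families of
    sets. *)
Lemma card_partitions U : #|[set P | partition P U]| = bell #|U|.
Proof.
pose f (i : 'I_#|U|) : T := enum_val i.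
have finj : injective f by exact: enum_val_inj.
have fU : f @: [set: 'I_#|U|] = U.
  apply/setP=> x; apply/imsetP/idP => [[i _ ->]|xU]; first exact: enum_valP.
  by exists (enum_rank_in xU x); rewrite ?inE // /f enum_rankK_in.
pose F (P : {set {set 'I_#|U|}}) := [set f @: (B : {set _}) | B in P].
have Finj : injective F by apply/imset_inj/imset_inj.
rewrite /bell -(card_imset _ Finj); apply: eq_card => P; rewrite !inE.
apply/idP/imsetP => [partP|[Q]]; last first.
  by rewrite inE => partQ ->; rewrite -fU imset_partition.
(* Surjectivity: each block of [P] lies in the image of [f], hence is the image of its own
   preimage. *)
have FK : P = F [set f @^-1: (B : {set T}) | B in P].
  rewrite /F -imset_comp -[LHS]imset_id; apply: eq_in_imset => B BP /=.
  apply/setP=> x; apply/idP/imsetP => [xB|[i]]; last by rewrite inE => ? ->.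
  have: x \in f @: [set: 'I_#|U|].
    by rewrite fU (subsetP (partitionS partP BP)).
  by case/imsetP=> i _ xi; exists i; rewrite ?inE -?xi.
exists [set f @^-1: (B : {set T}) | B in P] => //.
by rewrite inE -(imset_partition _ _ finj) -/(F _) -FK fU.
Qed.

Lemma partition_sub P Q X :
  partition P X -> Q \subset P -> partition Q (cover Q).
Proof.
case/and3P=> _ trivP P0 QP; rewrite /partition eqxx (trivIsetS QP trivP) /=.
by apply: contra P0; apply: subsetP.
Qed.

(** Disjointness of the blocks ensures that no point of a block outside [Q] is covered by [Q]. *)
Lemma partition_setD P Q X :
  partition P X -> Q \subset P -> partition (P :\: Q) (X :\: cover Q).
Proof.
move=> partP QP; have := partition_sub partP (subsetDl P Q).
suff -> : cover (P :\: Q) = X :\: cover Q by [].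
have trivP := partition_trivIset partP.
rewrite -(cover_partition partP); apply/setP=> x; rewrite inE.
apply/bigcupP/andP => [[B]|[xQ /bigcupP[B BP xB]]].
  rewrite inE => /andP[BQ BP] xB; split; last by apply/bigcupP; exists B.
  apply: contra BQ => /bigcupP[C CQ xC].
  have CP := subsetP QP C CQ.
  by rewrite -(def_pblock trivP BP xB) (def_pblock trivP CP xC).
exists B => //; rewrite inE BP andbT.
by apply: contra xQ => BQ; apply/bigcupP; exists B.
Qed.

Lemma partition_setU P Q U X :
    U \subset X -> partition P U -> partition Q (X :\: U) ->
  partition (P :|: Q) X.
Proof.
move=> UX /and3P[/eqP covP trivP P0] /and3P[/eqP covQ trivQ Q0].
have covPQ : cover (P :|: Q) = cover P :|: cover Q.
  by rewrite /cover bigcup_setU.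
apply/and3P; split; last by rewrite inE negb_or P0.
  by rewrite covPQ covP covQ -{1}(setIidPr UX) setID.
apply: trivIsetU => //; rewrite covP covQ.
by rewrite disjoint_sym disjoints_subset subsetDr.
Qed.

(** Each such [U] is uniquely [K :|: V] with [V] inside [X :\: K], so its size is [#|K| + #|V|]; the
    binomial coefficient counts the [V] of size [j]. *)
Lemma sum_between K X (F : nat -> nat) : K \subset X ->
  \sum_(U : {set T} | (K \subset U) && (U \subset X)) F #|U| =
  \sum_(0 <= j < (#|X| - #|K|).+1) 'C(#|X| - #|K|, j) * F (#|K| + j).
Proof.
move=> KX; have cXK : #|X :\: K| = #|X| - #|K| by rewrite cardsD (setIidPr KX).
have disj (V : {set T}) : V \subset X :\: K -> K :&: V = set0.
  by rewrite subsetD => /andP[_]; rewrite -setI_eq0 setIC => /eqP.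
rewrite (reindex_onto (fun V => K :|: V) (fun U => U :\: K)) /=; last first.
  by move=> U /andP[KU _]; rewrite -{1}(setIidPr KU) setID.
(* The reindexing condition [(K :|: V) :\: K == V] says exactly that [V] avoids [K]. *)
rewrite (eq_bigl (fun V : {set T} => V \subset X :\: K)); last first.
  move=> V; rewrite subsetUl subUset KX setDUl setDv set0U /= subsetD.
  by rewrite (sameP eqP setDidPl).
rewrite (eq_bigr (fun V : {set T} => F (#|K| + #|V|))); last first.
  by move=> V /disj KV; rewrite cardsU KV cards0 subn0.
rewrite -cXK big_mkord.
(* The size is cast into a finite type to serve as an index; [inord] loses nothing because [V] lies
   in [X :\: K]. *)
rewrite (partition_big (fun V : {set T} => inord #|V| : 'I_#|X :\: K|.+1) predT) //.
apply: eq_bigr => j _.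
rewrite -cards_draws -sum_nat_const; apply: eq_big => [V|V].
  rewrite inE; case: (boolP (V \subset _)) => //= /subset_leq_card cV.
  by rewrite -val_eqE /= inordK.
by case/andP=> /subset_leq_card cV /eqP <-; rewrite inordK.
Qed.

End Partitions.

(** * Labelled partitions as pairs of partitions, and their count *)

Section Labelled.
Variables (T : finType) (l : T).
Implicit Types (U X : {set T}) (P Q pi : {set {set T}}).

Definition label_blocks P Q : {set {set T}} := [set l |: B | B in P] :|: Q.

(** This recovers the subset [U] of the correspondence from [pi] alone. *)
Definition labelled_points pi : {set T} := cover (labelled_blocks l pi) :\ l.

(** Blocks of [Q] lie in [X] and so miss [l]. *)
Lemma label_blocks_labelled P Q X : l \notin X -> cover Q \subset X ->
  labelled_blocks l (label_blocks P Q) = [set l |: B | B in P].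
Proof.
move=> lX QX; apply/setP=> C; rewrite !inE.
case: (boolP (C \in [set l |: B | B in P])) => /= [/imsetP[B _ ->]|_].
  by rewrite setU11.
apply/andP=> -[CQ lC]; case/negP: lX; apply: (subsetP QX).
by apply/bigcupP; exists C.
Qed.

Lemma label_blocks_unlabelled P Q X : l \notin X -> cover Q \subset X ->
  label_blocks P Q :\: labelled_blocks l (label_blocks P Q) = Q.
Proof.
move=> lX QX; apply/setP=> C; rewrite !inE.
case: (boolP (C \in Q)) => CQ; last first.
  case: (boolP (C \in [set l |: B | B in P])) => [/imsetP[B _ ->]|] //=.
  by rewrite setU11.
rewrite orbT /= andbT; apply: contra lX => lC; apply: (subsetP QX).
by apply/bigcupP; exists C.
Qed.

Lemma unlabelK P : l \notin cover P ->
  [set C :\ l | C in [set l |: B | B in P]] = P.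
Proof.
move=> lP; rewrite -imset_comp -[RHS]imset_id; apply: eq_in_imset => B BP /=.
by rewrite setU1K //; apply: contra lP => lB; apply/bigcupP; exists B.
Qed.

Lemma labelled_points_label P Q U X : l \notin X -> U \subset X ->
    partition P U -> partition Q (X :\: U) ->
  labelled_points (label_blocks P Q) = U.
Proof.
move=> lX UX /cover_partition covP /cover_partition covQ.
have lP : l \notin cover P by rewrite covP; apply: contra lX; apply: subsetP.
have QX : cover Q \subset X by rewrite covQ subsetDl.
rewrite /labelled_points (label_blocks_labelled _ lX QX) cover_imset.
(* [U] is rewritten as a union of blocks with [l] erased one by one, to be compared with erasing [l]
   after the union. *)
rewrite -[in RHS]covP -[in RHS](unlabelK lP) cover_imset.
apply/setP=> x; rewrite !inE; apply/andP/bigcupP => [[xl /bigcupP[B BP xB]]|].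
  by exists (l |: B); rewrite ?imset_f // !inE xl; rewrite !inE in xB.
case=> _ /imsetP[B BP ->]; rewrite !inE => /andP[xl xB]; split=> //.
by apply/bigcupP; exists B; rewrite // !inE.
Qed.

(** A marking [S] of the blocks of a partition splits it into marked and unmarked blocks;
    conversely, two partitions are merged and the blocks of the first are marked. *)
Lemma labelled_partitionP X pi : l \notin X ->
  reflect (exists U P Q, [/\ U \subset X, partition P U,
                             partition Q (X :\: U) & pi = label_blocks P Q])
          (pi \in labelled_partitions l X).
Proof.
move=> lX; rewrite inE; apply: (iffP existsP).
  case=> P /andP[partP /existsP[S /eqP ->]].
  have PS := subsetIl P S.
  have partPS := partition_sub partP PS.
  (* [S] may contain sets that are not blocks, hence the intersection with [P]. *)
  exists (cover (P :&: S)), (P :&: S), (P :\: (P :&: S)); split=> //.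
  - rewrite -(cover_partition partP); apply/bigcupsP=> B /(subsetP PS) BP.
    exact: bigcup_sup.
  - exact: partition_setD.
  apply/setP=> C; rewrite !inE; apply/imsetP/orP => [[B BP ->]|[]].
  - case: ifP => BS; [left|right]; last by rewrite setU0 BP BS.
    by rewrite setUC imset_f // inE BP.
  - case/imsetP=> B; rewrite inE => /andP[BP BS] ->.
    by exists B; rewrite // BS setUC.
  rewrite negb_and andb_orl andNb /= => /andP[/negPf CS CP].
  by exists C; rewrite // CS setU0.
case=> U [P [Q [UX partP partQ ->]]].
exists (P :|: Q); rewrite (partition_setU UX partP partQ) /=.
apply/existsP; exists P; apply/eqP/setP=> C.
(* Blocks are nonempty, so a common block would have a point both inside and outside [U]; marking
   [P] therefore labels no block of [Q]. *)
have QP B : B \in Q -> B \in P = false.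
  move=> BQ; apply/negP=> BP.
  have /set0Pn[x xB] := partition_neq0 partQ BQ.
  have := subsetP (partitionS partQ BQ) x xB.
  by rewrite inE (subsetP (partitionS partP BP) x xB).
rewrite !inE; apply/orP/imsetP => [[/imsetP[B BP ->]|CQ]|[B]].
- by exists B; rewrite ?inE BP // setUC.
- by exists C; rewrite ?inE ?CQ ?orbT // QP // setU0.
rewrite inE => /orP[BP|BQ] ->; first by rewrite BP setUC imset_f //; left.
by rewrite QP // setU0; right.
Qed.

(** For fixed [U], the pair [(P, Q)] can be read off [label_blocks P Q]: [P] from the labelled
    blocks with [l] erased, [Q] from the remaining ones. *)
Lemma card_labelled_points_fiber X U : l \notin X -> U \subset X ->
  #|[set pi in labelled_partitions l X | labelled_points pi == U]| =
  bell #|U| * bell (#|X| - #|U|).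
Proof.
move=> lX UX.
have -> : #|X| - #|U| = #|X :\: U| by rewrite cardsD (setIidPr UX).
rewrite -!card_partitions -cardsX.
rewrite -(@card_in_imset _ _ (fun PQ => label_blocks PQ.1 PQ.2)); last first.
  move=> [P Q] [P' Q']; rewrite !inE /= => /andP[partP partQ].
  move=> /andP[partP' partQ'] eqPQ.
  have cov R : partition R (X :\: U) -> cover R \subset X.
    by move/cover_partition=> ->; apply: subsetDl.
  have lU R : partition R U -> l \notin cover R.
    by move/cover_partition=> ->; apply: contra lX; apply: subsetP.
  congr pair.
    rewrite -(unlabelK (lU _ partP)) -(unlabelK (lU _ partP')).
    rewrite -(label_blocks_labelled P lX (cov _ partQ)) eqPQ.
    by rewrite (label_blocks_labelled P' lX (cov _ partQ')).
  rewrite -(label_blocks_unlabelled P lX (cov _ partQ)) eqPQ.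
  exact: label_blocks_unlabelled (cov _ partQ').
apply: eq_card => pi; rewrite inE; apply/andP/imsetP.
  case=> /(labelled_partitionP _ lX)[V [P [Q [VX partP partQ ->]]]].
  rewrite (labelled_points_label lX VX partP partQ) => /eqP defV.
  rewrite {}defV in partP partQ.
  by exists (P, Q); rewrite // !inE partP partQ.
case=> -[P Q] inPQ ->.
have /andP[partP partQ] : partition P U && partition Q (X :\: U).
  by move: inPQ; rewrite !inE.
rewrite (labelled_points_label lX UX partP partQ) eqxx; split=> //.
by apply/(labelled_partitionP _ lX); exists U, P, Q.
Qed.

Lemma labelled_points_sub X pi : l \notin X ->
  pi \in labelled_partitions l X -> labelled_points pi \subset X.
Proof.
move=> lX /(labelled_partitionP _ lX)[U [P [Q [UX partP partQ ->]]]].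
by rewrite (labelled_points_label lX UX partP partQ).
Qed.

(** The labelled blocks come from a partition of the labelled points, and a partition has no blocks
    exactly when the set it partitions is empty. *)
Lemma labelled_blocks_eq0 X pi : l \notin X ->
    pi \in labelled_partitions l X ->
  (labelled_blocks l pi == set0) = (labelled_points pi == set0).
Proof.
move=> lX /(labelled_partitionP _ lX)[U [P [Q [UX partP partQ ->]]]].
have QX : cover Q \subset X by rewrite (cover_partition partQ) subsetDl.
rewrite (labelled_points_label lX UX partP partQ).
rewrite (label_blocks_labelled _ lX QX) imset_eq0.
apply/eqP/eqP => [P0|U0]; last by apply/eqP; rewrite -partition_set0 -U0.
by rewrite -(cover_partition partP) P0 /cover big_set0.
Qed.

(** With [l] erased, the [k] labelled blocks form a partition of the labelled points into
    singletons. *)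
Lemma card_labelled_points_singletons X k pi : l \notin X ->
  is_singleton_lp l X k pi -> #|labelled_points pi| = k.
Proof.
move=> lX /and3P[/(labelled_partitionP _ lX)[U [P [Q [UX partP partQ ->]]]]].
have QX : cover Q \subset X by rewrite (cover_partition partQ) subsetDl.
rewrite (labelled_points_label lX UX partP partQ).
rewrite (label_blocks_labelled _ lX QX) => /'forall_implyP sing /eqP <-.
have lB B : B \in P -> l \notin B.
  move=> BP; apply: contra lX; apply: subsetP.
  exact: subset_trans (partitionS partP BP) UX.
rewrite card_in_imset => [|B C BP CP eqBC]; last first.
  by rewrite -(setU1K (lB _ BP)) eqBC setU1K ?lB.
rewrite (card_uniform_partition _ partP (n := 1)) ?muln1 // => B BP.
rewrite -(setU1K (lB _ BP)); apply/eqP/sing.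
by rewrite inE imset_f.
Qed.

(** A block [{x, l}] of [pi0] fits into a block of [pi] exactly when [x] is a labelled point of
    [pi]; an unlabelled [{x}] fits into whichever block covers [x]. *)
Lemma refines_singletons X k pi0 pi : l \notin X ->
    is_singleton_lp l X k pi0 -> pi \in labelled_partitions l X ->
  refines pi0 pi = (labelled_points pi0 \subset labelled_points pi).
Proof.
move=> lX /and3P[pi0X /'forall_implyP sing _] piX.
apply/'forall_implyP/subsetP => [ref x|sub A Api0].
  rewrite inE => /andP[xl /bigcupP[A]].
  rewrite inE => /andP[Api0 lA] xA.
  have /'exists_andP[B [Bpi AB]] := ref A Api0.
  rewrite inE xl; apply/bigcupP; exists B; last exact: (subsetP AB).
  by rewrite inE Bpi (subsetP AB).
have /cards1P[x Ax] := sing A Api0.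
have /setD1P[xl xA] : x \in A :\ l by rewrite Ax inE.
apply/'exists_andP; case: (boolP (l \in A)) => lA.
  have: x \in labelled_points pi.
    by apply: sub; rewrite !inE xl; apply/bigcupP; exists A; rewrite // inE Api0.
  rewrite inE => /andP[_ /bigcupP[B]]; rewrite inE => /andP[Bpi lB] xB.
  by exists B; split; rewrite // -(setD1K lA) Ax subUset !sub1set lB.
have defA : A = [set x].
  by rewrite -Ax; apply/esym/setDidPl; rewrite disjoint_sym disjoints1.
(* Membership in [X] guarantees that some block of [pi] covers [x]. *)
have xX : x \in X.
  case/(labelled_partitionP _ lX): pi0X => U [P [Q [UX partP partQ]]] def0.
  move: Api0; rewrite def0 inE => /orP[/imsetP[B _ defB]|AQ].
    by case/negP: lA; rewrite defB setU11.
  by have := subsetP (partitionS partQ AQ) x xA; rewrite inE => /andP[].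
case/(labelled_partitionP _ lX): piX => U [P [Q [UX partP partQ ->]]].
case: (boolP (x \in U)) => xU.
  move: xU; rewrite -(cover_partition partP) => /bigcupP[B BP xB].
  by exists (l |: B); rewrite inE imset_f // defA sub1set inE xB orbT.
have: x \in X :\: U by rewrite inE xU.
rewrite -(cover_partition partQ) => /bigcupP[B BQ xB].
by exists B; rewrite inE BQ orbT defA sub1set.
Qed.

(** The partitions are grouped by their labelled points [U]. The conditional removes the term of the
    empty [U], which has no labelled block, so one formula serves both cases of the theorem. *)
Lemma num_labelled_above_sum X k pi0 : l \notin X ->
    is_singleton_lp l X k pi0 ->
  num_labelled_above l X pi0 =
  \sum_(0 <= j < (#|X| - k).+1)
     'C(#|X| - k, j) *
     (if k + j == 0 then 0 else bell (k + j) * bell (#|X| - (k + j))).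
Proof.
move=> lX sing; have pi0X : pi0 \in labelled_partitions l X by case/and3P: sing.
set F := fun m => if m == 0 then 0 else bell m * bell (#|X| - m).
have Kk := card_labelled_points_singletons lX sing.
have KX := labelled_points_sub lX pi0X.
rewrite -Kk -(sum_between F KX) /num_labelled_above.
rewrite -sum1_card (partition_big labelled_points
  (fun U => (labelled_points pi0 \subset U) && (U \subset X))) /=; last first.
  move=> pi; rewrite inE => /and3P[piX ref _].
  by rewrite -(refines_singletons lX sing piX) ref labelled_points_sub.
apply: eq_bigr => U /andP[KU UX]; rewrite sum1dep_card /F.
(* Over a fixed [U] containing the labelled points of [pi0], the two conditions on [pi] reduce to
   [U] being nonempty. *)
have eqU pi : pi \in labelled_partitions l X -> labelled_points pi = U ->
    refines pi0 pi && (labelled_blocks l pi != set0) = (U != set0).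
  move=> piX defU; rewrite (refines_singletons lX sing piX) defU KU.
  by rewrite (labelled_blocks_eq0 lX piX) defU.
rewrite cards_eq0; case: eqP => U0.
  apply: eq_card0 => pi; rewrite !inE; apply/negP => /andP[/andP[piX r] /eqP pU].
  by move: r; rewrite eqU ?inE // U0 eqxx.
rewrite -card_labelled_points_fiber //; apply: eq_card => pi; rewrite !inE.
case: (boolP (is_labelled_partition _ _ _)) => //= piX.
case: (labelled_points pi =P U) => pU; rewrite ?andbF // eqU ?inE // andbT.
exact/eqP.
Qed.

End Labelled.

Theorem theorem5p14 (T : finType) (l : T) (X : {set T}) (n k : nat)
    (pi0 : {set {set T}}) (hl : l \notin X) (hX : #|X| = n) (hn : 1 <= n)
    (hk : k <= n) (hpi0 : is_singleton_lp l X k pi0) :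
  (k = 0 ->
     num_labelled_above l X pi0 =
       \sum_(1 <= j < n.+1) 'C(n, j) * bell j * bell (n - j)) /\
  (1 <= k ->
     num_labelled_above l X pi0 =
       \sum_(0 <= j < (n - k).+1)
          'C(n - k, j) * bell (k + j) * bell (n - k - j)).
Proof.
rewrite (num_labelled_above_sum hl hpi0) hX; split=> [->|k_gt0].
  (* For [k = 0] only the index 0 meets the zero branch; splitting it off makes the sum start at
     1. *)
  rewrite subn0 big_ltn // muln0 add0n.
  rewrite big_nat [RHS]big_nat; apply: eq_bigr => j /andP[j_gt0 _].
  by rewrite add0n eqn0Ngt j_gt0 mulnA.
(* For positive [k], [k + j] never vanishes, so the zero branch is never taken. *)
apply: eq_bigr => j _.
by rewrite addn_eq0 eqn0Ngt k_gt0 /= subnDA mulnA.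
Qed.
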